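(* Let $X$ be a linear $n$-normed space over $\mathbb{K}$ and let $b_2,\dots,b_n\in X$ be fixed elements. If a sequence $\{x_k\}$ in $X$ converges $b$-strongly to $x\in X$, then $\{x_k\}$ converges $b$-weakly to $x$ in $X$.
   Context: Let $n$ be a positive integer and let $X$ be a linear space over $\mathbb{K}$ ($=\mathbb{R}$ or $\mathbb{C}$) with $\dim X\ge n$. An $n$-norm on $X$ is a function $\|\cdot,\dots,\cdot\|:X^n\to\mathbb{R}$ such that: (N1) $\|x_1,\dots,x_n\|=0$ if and only if $x_1,\dots,x_n$ are linearly dependent; (N2) $\|x_1,\dots,x_n\|$ is invariant under permutations of $x_1,\dots,x_n$; (N3) $\|\alpha x_1,x_2,\dots,x_n\|=|\alpha|\,\|x_1,x_2,\dots,x_n\|$ for all $\alpha\in\mathbb{K}$; (N4) $\|x+y,x_2,\dots,x_n\|\le\|x,x_2,\dots,x_n\|+\|y,x_2,\dots,x_n\|$. The pair $(X,\|\cdot,\dots,\cdot\|)$ is a linear $n$-normed space. Fix $b_2,\dots,b_n\in X$ and let $\langle b_i\rangle$ be the subspace generated by $b_i$. A $b$-linear functional on $X\times\langle b_2\rangle\times\cdots\times\langle b_n\rangle$ is a map $T:X\times\langle b_2\rangle\times\cdots\times\langle b_n\rangle\to\mathbb{K}$ with $T(x+y,b_2,\dots,b_n)=T(x,b_2,\dots,b_n)+T(y,b_2,\dots,b_n)$ and $T(kx,b_2,\dots,b_n)=k\,T(x,b_2,\dots,b_n)$ for all $x,y\in X$, $k\in\mathbb{K}$. It is bounded if there is $M>0$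 with $|T(x,b_2,\dots,b_n)|\le M\|x,b_2,\dots,b_n\|$ for all $x\in X$. $X_F^{*}$ denotes the set of all bounded $b$-linear functionals on $X\times\langle b_2\rangle\times\cdots\times\langle b_n\rangle$. A sequence $\{x_k\}$ in $X$ converges $b$-weakly to $x\in X$ if $\lim_{k\to\infty}T(x_k,b_2,\dots,b_n)=T(x,b_2,\dots,b_n)$ for every $T\in X_F^{*}$; it converges $b$-strongly to $x$ if $\lim_{k\to\infty}\|x_k-x,b_2,\dots,b_n\|=0$. *)

(* Defs.v *)
From HB Require Import structures.
From mathcomp Require Import all_boot all_order all_fingroup all_algebra.
From mathcomp Require Import complex.
From mathcomp Require Import all_classical all_reals all_analysis.
Import Order.TTheory GRing.Theory Num.Theory.
Import numFieldNormedType.Exports.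

Set Implicit Arguments.
Unset Strict Implicit.
Unset Printing Implicit Defensive.

Local Open Scope classical_set_scope.
Local Open Scope ring_scope.
Local Open Scope complex_scope.

Variant scalar_kind := RealScalars | ComplexScalars.

Definition scalars (R : realType) (F : scalar_kind) : numFieldType :=
  match F with RealScalars => R | ComplexScalars => R[i] end.

(* The real-valued absolute value; the norm of the numFieldType R[i] takes its
   values in R[i] itself, so it cannot be compared with an n-norm directly. *)
Definition modulus (R : realType) (F : scalar_kind) : scalars R F -> R :=
  match F with
  | RealScalars => fun a : R => `|a|
  | ComplexScalars => fun z : R[i] => ComplexField.Normc.normc z
  end.

Definition lin_dependent (K : numFieldType) (X : lmodType K) (n : nat)
    (t : n.-tuple X) : Prop :=
  exists2 a : 'I_n -> K,
    exists i, a i <> 0 & \sum_(i < n) a i *: tnth t i = 0.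

Definition dim_ge (K : numFieldType) (X : lmodType K) (n : nat) : Prop :=
  exists t : n.-tuple X, ~ lin_dependent t.

(* The positive arity is written n.+1, so that a point of X^(n.+1) splits as a
   first vector x followed by an n-tuple. *)
Record is_nnorm (R : realType) (F : scalar_kind) (X : lmodType (scalars R F))
    (n : nat) (N : n.+1.-tuple X -> R) : Prop := IsNNorm {
  nnorm_eq0 : forall t, N t = 0 <-> lin_dependent t ;
  nnorm_perm : forall (s : 'S_n.+1) t,
    N [tuple tnth t (s i) | i < n.+1] = N t ;
  nnormZ : forall (a : scalars R F) x (t : n.-tuple X),
    N [tuple of a *: x :: t] = modulus a * N [tuple of x :: t] ;
  nnormD : forall x y (t : n.-tuple X),
    N [tuple of (x + y) :: t] <= N [tuple of x :: t] + N [tuple of y :: t]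
}.

Record is_nnormed_space (R : realType) (F : scalar_kind)
    (X : lmodType (scalars R F)) (n : nat) (N : n.+1.-tuple X -> R) : Prop :=
  IsNNormedSpace {
    nnormed_space_dim : dim_ge X n.+1 ;
    nnormed_space_nnorm : is_nnorm N
  }.

Definition line (K : numFieldType) (X : lmodType K) (v : X) : set X :=
  range (fun a : K => a *: v).

Lemma line_gen (K : numFieldType) (X : lmodType K) (v : X) : line v v.
Proof. by exists 1; rewrite ?scale1r. Qed.

Definition lines (K : numFieldType) (X : lmodType K) (n : nat)
  (b : n.-tuple X) := forall i : 'I_n, line (tnth b i).

Definition gens (K : numFieldType) (X : lmodType K) (n : nat)
    (b : n.-tuple X) : lines b :=
  fun i => SigSub (mem_set (line_gen (tnth b i))).

(* The tuple b collects b_2, ..., b_n. Additivity and homogeneity are required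
   only at the point (b_2, ..., b_n) of the product of lines. *)
Definition blinear (K : numFieldType) (X : lmodType K) (n : nat)
    (b : n.-tuple X) (T : X -> lines b -> K) : Prop :=
  (forall x y, T (x + y) (gens b) = T x (gens b) + T y (gens b)) /\
  (forall (a : K) x, T (a *: x) (gens b) = a * T x (gens b)).

Definition bbounded (R : realType) (F : scalar_kind)
    (X : lmodType (scalars R F)) (n : nat) (N : n.+1.-tuple X -> R)
    (b : n.-tuple X) (T : X -> lines b -> scalars R F) : Prop :=
  exists2 M : R, 0 < M &
    forall x, modulus (T x (gens b)) <= M * N [tuple of x :: b].

Definition bdual (R : realType) (F : scalar_kind) (X : lmodType (scalars R F))
    (n : nat) (N : n.+1.-tuple X -> R) (b : n.-tuple X) :
    set (X -> lines b -> scalars R F) :=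
  [set T | blinear T /\ bbounded N T].
Arguments bdual {R F X n} N b.

Definition bweakly_cvg (R : realType) (F : scalar_kind)
    (X : lmodType (scalars R F)) (n : nat) (N : n.+1.-tuple X -> R)
    (b : n.-tuple X) (u : nat -> X) (x : X) : Prop :=
  forall T, bdual N b T -> T (u k) (gens b) @[k --> \oo] --> T x (gens b).

Definition bstrongly_cvg (R : realType) (F : scalar_kind)
    (X : lmodType (scalars R F)) (n : nat) (N : n.+1.-tuple X -> R)
    (b : n.-tuple X) (u : nat -> X) (x : X) : Prop :=
  N [tuple of u k - x :: b] @[k --> \oo] --> (0 : R).

(* Main.v *)
Require Import Defs.
From HB Require Import structures.
From mathcomp Require Import all_boot all_order all_fingroup all_algebra.
From mathcomp Require Import complex.
From mathcomp Require Import all_classical all_reals all_analysis.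
Import Order.TTheory GRing.Theory Num.Theory.
Import numFieldNormedType.Exports.

Set Implicit Arguments.
Unset Strict Implicit.
Unset Printing Implicit Defensive.

Local Open Scope classical_set_scope.
Local Open Scope ring_scope.

(** A bounded functional is Lipschitz for the seminorm [N [tuple of _ :: b]]:
    by additivity and homogeneity, [T y - T x = T (y - x)], whose modulus is at
    most a constant multiple [M] of [N [tuple of y - x :: b]]. Strong
    convergence says that this seminorm of [u k - x] tends to [0], hence so
    does [T (u k) - T x]. The only link to make is between the real-valued
    [modulus], in which boundedness is expressed, and the norm defining the
    topology of the scalars, which for complex scalars is complex-valued; this
    is [modulus_lt_norm]. *)

(** A positive complex number is real, so the radii of the balls of the scalar
    field can be taken in [R], whatever the kind of scalars. *)
Lemma modulus_lt_norm (R : realType) (F : scalar_kind) (e : scalars R F) :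
  0 < e ->
  exists2 d : R, 0 < d & forall a : scalars R F, modulus a < d -> `|a| < e.
Proof.
case: F e => /= e e_gt0; first by exists e.
case: e e_gt0 => er ei; rewrite ltcE /= => /andP[/eqP-> er_gt0].
by exists er => // a a_lt; rewrite ltcE /= eqxx.
Qed.

Lemma blinearB (K : numFieldType) (X : lmodType K) (n : nat) (b : n.-tuple X)
    (T : X -> lines b -> K) (x y : X) :
  blinear T -> T (x - y) (gens b) = T x (gens b) - T y (gens b).
Proof. by case=> TD TZ; rewrite TD -scaleN1r TZ mulN1r. Qed.

Theorem theorem5p6 (R : realType) (F : scalar_kind)
    (X : lmodType (scalars R F)) (n : nat) (N : n.+1.-tuple X -> R)
    (hN : is_nnormed_space N) (b : n.-tuple X) (u : nat -> X) (x : X) :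
  bstrongly_cvg N b u x -> bweakly_cvg N b u x.
Proof.
move=> u_x T [T_lin [M M_gt0 T_le]].
apply/cvgrPdistC_lt => e /modulus_lt_norm[d d_gt0 d_e].
have dM_gt0 : 0 < d / M by rewrite divr_gt0.
have /cvgr_lt/(_ _ dM_gt0) := u_x.
apply: filterS => k; rewrite ltr_pdivlMr // mulrC => N_lt.
by rewrite -blinearB//; apply/d_e/(le_lt_trans (T_le _)).
Qed.
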